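(* A formula $\varphi$ of $\mathcal L$ is satisfiable (respectively, falsifiable) in some intuitionistic dynamic model if and only if it is satisfiable (respectively, falsifiable) in some expanding model.
   Context: Formulas of $\mathcal L$: $\varphi::= p\mid\bot\mid\varphi\wedge\varphi\mid\varphi\vee\varphi\mid\varphi\to\varphi\mid\bigcirc\varphi\mid\Diamond\varphi\mid\Box\varphi$, $p$ in a countable set $\mathbb P$. An intuitionistic dynamic model is $\mathcal M=(W,\preccurlyeq,S,V)$ with $W\neq\emptyset$, $\preccurlyeq$ a partial order, $S\colon W\to W$ with $w\preccurlyeq v\Rightarrow S(w)\preccurlyeq S(v)$, and $V\colon W\to 2^{\mathbb P}$ with $w\preccurlyeq v\Rightarrow V(w)\subseteq V(v)$. With $S^0(w)=w$, $S^{k+1}(w)=S(S^k(w))$: $w\models p$ iff $p\in V(w)$; $\bot$ never; $\wedge,\vee$ as usual; $w\models\varphi\to\psi$ iff for all $v\succcurlyeq w$, $v\models\varphi$ implies $v\models\psi$; $w\models\bigcirc\varphi$ iff $S(w)\models\varphi$; $w\models\Diamond\varphi$ iff $S^k(w)\models\varphi$ for some $k\ge0$; $w\models\Box\varphi$ iff $S^k(w)\models\varphi$ for all $k\ge0$. Satisfiable: true at some world of the model; falsifiable: false at some world of the model. A poset $(U,\le)$ is a tree if there is a relation $\lhd$ on $U$ whose reflexive transitive closure is $\le$ and an element $r$ (the root) such that for every $u\in U$ there is a unique finite sequence $r=v_0\lhd v_1\lhd\dots\lhd v_n=u$. A model is stratified if there is a partition $\{W_n\}_{n<\omega}$ of $W$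 such that (i) each $W_n$ is closed under $\preccurlyeq$, (ii) each $(W_n,\preccurlyeq\restriction W_n)$ is a tree, and (iii) $w\in W_n$ implies $S(w)\in W_{n+1}$. An expanding model is a stratified model that moreover satisfies: $S(w)\preccurlyeq S(v)$ implies $w\preccurlyeq v$. *)

(* Defs.v *)
From Stdlib Require Export List Relations Sorted FinFun.

Inductive form (P : Type) : Type :=
| Var (p : P)
| Bot
| And (phi psi : form P)
| Or (phi psi : form P)
| Imp (phi psi : form P)
| Next (phi : form P)
| Dia (phi : form P)
| Box (phi : form P).

Arguments Var {P} p.
Arguments Bot {P}.
Arguments And {P} phi psi.
Arguments Or {P} phi psi.
Arguments Imp {P} phi psi.
Arguments Next {P} phi.
Arguments Dia {P} phi.
Arguments Box {P} phi.

Record model (P : Type) : Type := Model {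
  world : Type;
  le : relation world;
  step : world -> world;
  val : world -> P -> Prop;
  world_inhabited : inhabited world;
  le_order : order world le;
  step_mono : forall w v, le w v -> le (step w) (step v);
  val_mono : forall w v, le w v -> forall p, val w p -> val v p
}.

Arguments world {P} m.
Arguments le {P} m.
Arguments step {P} m.
Arguments val {P} m.

Fixpoint sat {P : Type} (M : model P) (w : world M) (phi : form P) : Prop :=
  match phi with
  | Var p => val M w p
  | Bot => False
  | And a b => sat M w a /\ sat M w b
  | Or a b => sat M w a \/ sat M w b
  | Imp a b => forall v, le M w v -> sat M v a -> sat M v b
  | Next a => sat M (step M w) a
  | Dia a => exists k : nat, sat M (Nat.iter k (step M) w) a
  | Box a => forall k : nat, sat M (Nat.iter k (step M) w) a
  end.

Definition satisfiable_in {P : Type} (M : model P) (phi : form P) : Prop :=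
  exists w, sat M w phi.

Definition falsifiable_in {P : Type} (M : model P) (phi : form P) : Prop :=
  exists w, ~ sat M w phi.

(* A finite sequence r = v_0 <| v_1 <| ... <| v_n = u is coded by the list
   s = [v_1; ...; v_n].  [Sorted lhd (r :: s)] only relates consecutive
   entries ([lhd] need not be transitive), and [last s r] is v_n (which is r
   when s is empty). *)
Definition is_tree {U : Type} (leU : relation U) : Prop :=
  exists (lhd : relation U) (r : U),
    (forall u v, clos_refl_trans U lhd u v <-> leU u v) /\
    (forall u, exists! s : list U, Sorted lhd (r :: s) /\ last s r = u).

Definition stratification {P : Type} (M : model P)
    (L : nat -> world M -> Prop) : Prop :=
  (forall n, exists w, L n w) /\
  (forall w, exists! n, L n w) /\
  (forall n w v, L n w -> le M w v -> L n v) /\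
  (forall n, is_tree (fun x y : {w : world M | L n w} =>
                        le M (proj1_sig x) (proj1_sig y))) /\
  (forall n w, L n w -> L (n + 1) (step M w)).

Definition stratified {P : Type} (M : model P) : Prop :=
  exists L : nat -> world M -> Prop, stratification M L.

Definition expanding {P : Type} (M : model P) : Prop :=
  stratified M /\
  (forall w v, le M (step M w) (step M v) -> le M w v).

(* Main.v *)
Require Import Defs.
From Stdlib Require Import Lia ProofIrrelevance.

(** Unravel a model [M] from a world [w0].  A node of layer [n] is an increasing
    chain over [S^n(w0)], except that its entries are trajectories
    [g : nat -> world M] which follow [step M] from time [n] on; at layer [n],
    [g] stands for the world [g n].  The nodes are ordered by extension of
    chains, so each layer is a tree, and the successor of a node is the same
    chain viewed at layer [n + 1], so the successor function reflects the order.
    Evaluating the last entry at the current time is a bounded morphism to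
    [M], because a chain at layer [n] can be extended by a trajectory that is
    born at time [n] in any world above its last one. *)

Set Implicit Arguments.

(** * Sequences read from their last entry *)

Lemma last_cons_default (A : Type) (s : list A) : forall a d,
  last (a :: s) d = last s a.
Proof.
induction s as [|b s IH]; intros a d; [reflexivity|].
change (last (b :: s) d = last (b :: s) a).
now rewrite !IH.
Qed.

(** Paths from a root grow at their end, whereas [Sorted] unfolds from the front; this permits
    induction from the end. *)
Lemma Sorted_snoc (A : Type) (R : relation A) (s : list A) (u : A) : forall r,
  Sorted R (r :: s ++ u :: nil) <-> Sorted R (r :: s) /\ R (last s r) u.
Proof.
induction s as [|a s IH]; intros r.
- simpl; split.
  + intros H; inversion_clear H as [|? ? _ Hr]; inversion_clear Hr; auto.
  + intros [_ H]; auto.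
- rewrite last_cons_default; split.
  + intros H; inversion_clear H as [|? ? Hs Hr].
    apply IH in Hs as [Hs Hu]; split; [|exact Hu].
    constructor; [exact Hs|]; inversion_clear Hr; auto.
  + intros [H Hu]; inversion_clear H as [|? ? Hs Hr].
    simpl; constructor; [now apply IH|].
    inversion_clear Hr; auto.
Qed.

(** * Tree structure of a suffix-closed family of lists *)

Section SuffixTree.

Variables (U A : Type) (code : U -> list A) (leU : relation U).
Hypothesis code_inj : forall u v, code u = code v -> u = v.
Hypothesis code_nil : exists r, code r = nil.
Hypothesis code_tl : forall u a l, code u = a :: l -> exists v, code v = l.
Hypothesis leU_suffix : forall u v, leU u v <-> exists k, code v = k ++ code u.

Let lhd : relation U := fun u v => exists a, code v = a :: code u.

(** An extension [k] is added one entry at a time; [code_tl] supplies the intermediate elements. *)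
Lemma clos_refl_trans_suffix u v : clos_refl_trans U lhd u v <-> leU u v.
Proof.
rewrite leU_suffix; split.
- induction 1 as [x y [a E]|x|x y z _ [k1 E1] _ [k2 E2]].
  + now exists (a :: nil).
  + now exists nil.
  + exists (k2 ++ k1); now rewrite E2, E1, app_assoc.
- intros [k E]; revert v E; induction k as [|a k IH]; intros v E.
  + rewrite (code_inj E); apply rt_refl.
  + destruct (code_tl E) as [w Ew].
    apply rt_trans with w; [now apply IH|].
    apply rt_step; exists a; now rewrite E, Ew.
Qed.

(** A nonempty code determines its tail, so [u] has exactly one [lhd]-predecessor, and every path to
    [u] is a path to that predecessor followed by [u]. *)
Lemma suffix_branch (r : U) (code_r : code r = nil) : forall l u, code u = l ->
  exists! s : list U, Sorted lhd (r :: s) /\ last s r = u.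
Proof.
induction l as [|a l IH]; intros u Eu.
- exists nil; split.
  + split; [auto|]; apply code_inj; now simpl; rewrite code_r, Eu.
  + intros s [Hs Hl].
    destruct s as [|v s _] using rev_ind; [reflexivity|].
    apply Sorted_snoc in Hs as [_ [b E]].
    rewrite last_last in Hl; congruence.
- destruct (code_tl Eu) as [w Ew].
  destruct (IH w Ew) as [s [[Hs Hl] Uniq]].
  exists (s ++ u :: nil); split.
  + rewrite last_last, Sorted_snoc, Hl; repeat split; auto.
    exists a; now rewrite Eu, Ew.
  + intros s' [Hs' Hl'].
    destruct s' as [|v s' _] using rev_ind; [simpl in Hl'; congruence|].
    rewrite last_last in Hl'; subst v.
    apply Sorted_snoc in Hs' as [Hs' [b E]].
    rewrite Eu in E; injection E as _ El.
    f_equal; apply Uniq; split; [exact Hs'|].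
    apply code_inj; congruence.
Qed.

Lemma is_tree_suffix : is_tree leU.
Proof.
destruct code_nil as [r Er].
exists lhd, r; split; [exact clos_refl_trans_suffix|].
intros u; exact (suffix_branch Er eq_refl).
Qed.

End SuffixTree.

(** * Chains of trajectories and the nodes they form *)

Section Unravelling.

Variables (P : Type) (M : model P) (w0 : world M).

Definition trajectory_from (n : nat) (g : nat -> world M) : Prop :=
  forall k, n <= k -> g (S k) = step M (g k).

(** Truncated subtraction gives the junk value [v] before time [n]; chains at layer [n] or later
    never inspect it. *)
Definition born_at (n : nat) (v : world M) : nat -> world M :=
  fun k => Nat.iter (k - n) (step M) v.

(* Chains are listed in reverse, so that extending one is consing; the root
   [S^n(w0)] is implicit. *)
Definition top (n : nat) (l : list (nat -> world M)) : world M :=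
  match l with
  | nil => Nat.iter n (step M) w0
  | g :: _ => g n
  end.

Fixpoint chain (n : nat) (l : list (nat -> world M)) : Prop :=
  match l with
  | nil => True
  | g :: l' => trajectory_from n g /\ le M (top n l') (g n) /\ chain n l'
  end.

Lemma born_at_birth n v : born_at n v n = v.
Proof. unfold born_at; now rewrite PeanoNat.Nat.sub_diag. Qed.

Lemma trajectory_born_at n v : trajectory_from n (born_at n v).
Proof.
intros k Hk; unfold born_at.
now rewrite PeanoNat.Nat.sub_succ_l by exact Hk.
Qed.

Lemma top_succ n l : chain n l -> top (S n) l = step M (top n l).
Proof.
destruct l as [|g l]; simpl; [reflexivity|].
intros [Hg _]; now apply Hg.
Qed.

(** The list need not change: its trajectories move by [step M], which preserves the inequalities
    between consecutive entries. *)
Lemma chain_succ n l : chain n l -> chain (S n) l.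
Proof.
induction l as [|g l IH]; simpl; [auto|].
intros [Hg [Hle Hl]]; split; [|split].
- intros k Hk; apply Hg; lia.
- rewrite top_succ, Hg by auto; now apply step_mono.
- auto.
Qed.

Lemma chain_suffix n k l : chain n (k ++ l) -> chain n l.
Proof. induction k as [|g k IH]; simpl; tauto. Qed.

Lemma le_top n k l : chain n (k ++ l) -> le M (top n l) (top n (k ++ l)).
Proof.
destruct (le_order _ M) as [le_refl le_trans _].
induction k as [|g k IH]; simpl; [auto|].
intros [_ [Hle Hl]]; apply le_trans with (top n (k ++ l)); auto.
Qed.

Record node : Type := Node {
  layer : nat;
  branch : list (nat -> world M);
  branch_chain : chain layer branch
}.

Lemma node_ext x y : layer x = layer y -> branch x = branch y -> x = y.
Proof.
destruct x as [n l H], y as [n' l' H']; simpl; intros <- <-.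
f_equal; apply proof_irrelevance.
Qed.

(** One list can be a chain at several layers, so equality of layers is demanded separately. *)
Definition node_le (x y : node) : Prop :=
  layer x = layer y /\ exists k, branch y = k ++ branch x.

Definition node_step (x : node) : node :=
  Node (S (layer x)) (branch x) (chain_succ _ _ (branch_chain x)).

Definition node_top (x : node) : world M := top (layer x) (branch x).

Definition root (n : nat) : node := Node n nil I.

Lemma node_top_step x : node_top (node_step x) = step M (node_top x).
Proof. exact (top_succ _ _ (branch_chain x)). Qed.

Lemma node_top_iter k x :
  node_top (Nat.iter k node_step x) = Nat.iter k (step M) (node_top x).
Proof.
induction k as [|k IH]; simpl; [reflexivity|].
now rewrite node_top_step, IH.
Qed.

Lemma node_top_mono x y : node_le x y -> le M (node_top x) (node_top y).
Proof.
intros [En [k Ek]]; unfold node_top; rewrite En, Ek.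
apply le_top; rewrite <- Ek; exact (branch_chain y).
Qed.

(** The back condition of a bounded morphism, needed for implication. *)
Lemma node_extend x v :
  le M (node_top x) v -> exists y, node_le x y /\ node_top y = v.
Proof.
intros Hv; set (g := born_at (layer x) v).
assert (H : chain (layer x) (g :: branch x)).
{ simpl; unfold g; rewrite born_at_birth.
  auto using trajectory_born_at, branch_chain. }
exists (Node _ _ H); split.
- split; [reflexivity|]; now exists (g :: nil).
- apply born_at_birth.
Qed.

Lemma node_le_order : order node node_le.
Proof.
split.
- intros x; split; [reflexivity|]; now exists nil.
- intros x y z [E1 [k1 F1]] [E2 [k2 F2]]; split; [congruence|].
  exists (k2 ++ k1); now rewrite F2, F1, app_assoc.
- intros x y [E [k1 F1]] [_ [k2 F2]]; apply node_ext; [exact E|].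
  (* Comparing lengths forces both extensions to be empty. *)
  rewrite F1 in F2; apply (f_equal (@length _)) in F2.
  rewrite !length_app in F2.
  destruct k1; [now rewrite F1|simpl in F2; lia].
Qed.

Lemma node_step_mono x y : node_le x y -> node_le (node_step x) (node_step y).
Proof. intros [E F]; split; simpl; auto. Qed.

Lemma node_val_mono x y : node_le x y ->
  forall p, val M (node_top x) p -> val M (node_top y) p.
Proof. intros H; now apply val_mono, node_top_mono. Qed.

(** * The unravelled model: expansion and preservation of truth *)

Definition unravelling : model P :=
  @Model P node node_le node_step (fun x => val M (node_top x))
    (inhabits (root 0)) node_le_order node_step_mono node_val_mono.

Lemma layer_is_tree n :
  is_tree (fun x y : {w : world unravelling | layer w = n} =>
             le unravelling (proj1_sig x) (proj1_sig y)).
Proof.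
apply is_tree_suffix with (code := fun x => branch (proj1_sig x)).
- intros [x Hx] [y Hy]; simpl; intros E.
  apply subset_eq_compat, node_ext; congruence.
- now exists (exist (fun x => layer x = n) (root n) eq_refl).
- intros [x Hx] g l; simpl; intros E.
  assert (H : chain n l).
  { rewrite <- Hx; apply (chain_suffix _ (g :: nil)); simpl app.
    rewrite <- E; exact (branch_chain x). }
  now exists (exist (fun x => layer x = n) (Node n l H) eq_refl).
- intros [x Hx] [y Hy]; simpl; unfold node_le; intuition congruence.
Qed.

Lemma unravelling_expanding : expanding unravelling.
Proof.
split.
- exists (fun n x => layer x = n); split; [|split; [|split; [|split]]].
  + intros n; now exists (root n).
  + intros x; exists (layer x); now split.
  + intros n x y E [F _]; congruence.
  + exact layer_is_tree.
  + intros n x E; simpl; lia.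
(* [node_step] keeps the branch and applies the injective [S] to the layer, so it reflects the
   order. *)
- intros x y [E F]; split; [now injection E|exact F].
Qed.

Lemma sat_unravelling phi : forall x : world unravelling,
  sat unravelling x phi <-> sat M (node_top x) phi.
Proof.
induction phi as [p| |a IHa b IHb|a IHa b IHb|a IHa b IHb|a IHa|a IHa|a IHa];
  intros x; simpl.
- reflexivity.
- reflexivity.
- now rewrite IHa, IHb.
- now rewrite IHa, IHb.
- split.
  + intros H v Hv; destruct (node_extend x v Hv) as [y [Hy <-]].
    rewrite <- IHa, <- IHb; now apply H.
  + intros H y Hy; rewrite IHa, IHb; now apply H, node_top_mono.
- now rewrite IHa, node_top_step.
- split; intros [k Hk]; exists k; [rewrite <- node_top_iter|];
    apply IHa; [exact Hk|now rewrite node_top_iter].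
- split; intros H k; specialize (H k); [rewrite <- node_top_iter|];
    apply IHa; [exact H|now rewrite node_top_iter].
Qed.

End Unravelling.

Unset Implicit Arguments.

Theorem theorem8 (P : Type) (P_countable : exists f : P -> nat, Injective f)
    (phi : form P) :
  ((exists M : model P, satisfiable_in M phi) <->
   (exists M : model P, expanding M /\ satisfiable_in M phi)) /\
  ((exists M : model P, falsifiable_in M phi) <->
   (exists M : model P, expanding M /\ falsifiable_in M phi)).
Proof.
split; split; try (intros [M [_ H]]; now exists M);
  (* The root of layer 0 evaluates to [w] itself, so it satisfies exactly the formulas true at
     [w]. *)
  intros [M [w Hw]]; exists (unravelling M w);
  (split; [apply unravelling_expanding|]); exists (root M w 0);
  now rewrite sat_unravelling.
Qed.
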